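(* Fix $0<t<\pi/2$. For $\lambda\in\mathbb{R}$ let $y$ be the solution on $[0,1]$ of $y''+\psi_0y=\lambda\psi_1y$ with $y(0)=1$, $y'(0)=0$, and let $$\kappa(\lambda)=y(1)^2-2y(1)y'(1).$$ Let $\lambda_\infty=\tfrac14\cot2t$. Then $\kappa$ is given by the power series $$\kappa(\lambda)=\sum_{n=0}^\infty a_n(\lambda-\lambda_\infty)^n,\qquad a_n=-2\sum_{k=0}^n\widetilde X^{(2k)}(1)\,\widetilde X^{(2(n-k)-1)}(1),$$ where $\widetilde X^{(-1)}=0$. Moreover $a_0=0$ and $a_n<0$ for all $n\ge1$. In particular, for $\lambda>\lambda_\infty$ one has $\kappa(\lambda)\neq0$ and $d\kappa/d\lambda<0$, and $\kappa(\lambda)\to-\infty$ as $\lambda\to\infty$.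
   Context: With $a=e^{it}$, $$\psi_0(z)=\frac34\left(\frac{a^2}{(z^2-a^2)^2}+\frac{\overline a^2}{(z^2-\overline a^2)^2}\right),\qquad \psi_1(z)=-i\left(\frac1{z^2-a^2}-\frac1{z^2-\overline a^2}\right)=\frac{2\sin 2t}{z^4-2(\cos 2t)z^2+1}.$$ Let $y_\infty(z)=(1-2(\cos2t)z^2+z^4)^{1/4}$ on $[0,1]$ (positive root), and put $q_0=1/y_\infty^2$, $q_1=\psi_1y_\infty^2$. The functions $\widetilde X^{(n)}$ on $[0,1]$ are the iterated integrals determined by the pair $(q_1,q_0)$: $\widetilde X^{(0)}=1$ and, for $n\ge1$, $$\widetilde X^{(n)}(z)=\int_0^z\widetilde X^{(n-1)}(\zeta)\,q(\zeta)\,d\zeta,\qquad q=q_1\text{ if } n \text{ is odd},\quad q=q_0\text{ if } n\text{ is even}.$$ *)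

(* Defs.v *)
From Stdlib Require Import Reals Lra ZArith.
From Coquelicot Require Import Coquelicot.
Open Scope R_scope.

(* a = e^{it} *)
Definition expit (t : R) : C := (cos t, sin t).

Definition psi0C (t : R) (z : C) : C :=
  let a := expit t in
  (RtoC (3 / 4) * (a ^ 2 / (z ^ 2 - a ^ 2) ^ 2
                   + Cconj a ^ 2 / (z ^ 2 - Cconj a ^ 2) ^ 2))%C.

Definition psi1C (t : R) (z : C) : C :=
  let a := expit t in
  (- Ci * (/ (z ^ 2 - a ^ 2) - / (z ^ 2 - Cconj a ^ 2)))%C.

(* On the real line both functions are real-valued (psi0C_real and psi1C_real
   below), so taking real parts loses nothing. *)
Definition psi0 (t x : R) : R := Re (psi0C t (RtoC x)).
Definition psi1 (t x : R) : R := Re (psi1C t (RtoC x)).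

Definition I01 (x : R) : Prop := 0 <= x <= 1.

(* y is a solution on [0,1] of y'' + psi0 y = lam psi1 y, y(0) = 1, y'(0) = 0,
   and dy is its derivative there. Derivatives are relative to [0,1], hence
   one-sided at the two endpoints. *)
Definition is_solution (t lam : R) (y dy : R -> R) : Prop :=
  y 0 = 1 /\ dy 0 = 0 /\
  exists ddy : R -> R,
    forall x : R, I01 x ->
      D_in y dy I01 x /\ D_in dy ddy I01 x /\
      ddy x + psi0 t x * y x = lam * psi1 t x * y x.

(* The base is |z^2 - a^2|^2, which is positive for 0 < t < PI/2 and real z, so
   Rpower is the positive fourth root. *)
Definition yinf (t z : R) : R :=
  Rpower (1 - 2 * cos (2 * t) * z ^ 2 + z ^ 4) (1 / 4).

Definition q0 (t z : R) : R := 1 / yinf t z ^ 2.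
Definition q1 (t z : R) : R := psi1 t z * yinf t z ^ 2.

Fixpoint Xnat (t : R) (n : nat) (z : R) {struct n} : R :=
  match n with
  | O => 1
  | S m => RInt (fun s => Xnat t m s *
                          (if Nat.odd n then q1 t s else q0 t s)) 0 z
  end.

(* Integer-indexed so that the index -1, where the value is 0, makes sense. *)
Definition Xtilde (t : R) (n : Z) (z : R) : R :=
  if (n <? 0)%Z then 0 else Xnat t (Z.to_nat n) z.

Definition lam_inf (t : R) : R := 1 / 4 * (cos (2 * t) / sin (2 * t)).

Definition acoef (t : R) (n : nat) : R :=
  - 2 * sum_f_R0 (fun k : nat =>
      Xtilde t (2 * Z.of_nat k) 1 *
      Xtilde t (2 * (Z.of_nat n - Z.of_nat k) - 1) 1) n.

Lemma Cinv_conj_total (w : C) : Cconj (/ w)%C = (/ Cconj w)%C.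
Proof.
destruct w as [u v]; unfold Cconj, Cinv; simpl.
apply injective_projections; simpl; unfold Rdiv;
  replace (u * (u * 1) + - v * (- v * 1)) with (u * (u * 1) + v * (v * 1)) by ring;
  ring.
Qed.

Lemma conj_fix_real (w : C) : Cconj w = w -> w = RtoC (Re w).
Proof.
destruct w as [u v]; unfold Cconj, RtoC, Re; simpl; intros H.
injection H; intros Hv; f_equal; lra.
Qed.

Lemma Cconj_RtoC (x : R) : Cconj (RtoC x) = RtoC x.
Proof. unfold Cconj, RtoC; simpl; f_equal; ring. Qed.

Lemma psi0C_real (t x : R) : psi0C t (RtoC x) = RtoC (psi0 t x).
Proof.
apply conj_fix_real; unfold psi0C, Cdiv.
rewrite Cmult_conj, Cplus_conj, !Cmult_conj, !Cinv_conj_total, !Cpow_conj,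
  !Cminus_conj, !Cpow_conj, !Cconj_conj, !Cconj_RtoC.
ring.
Qed.

Lemma psi1C_real (t x : R) : psi1C t (RtoC x) = RtoC (psi1 t x).
Proof.
apply conj_fix_real; unfold psi1C.
rewrite Cmult_conj, Copp_conj, Cminus_conj, !Cinv_conj_total,
  !Cminus_conj, !Cpow_conj, !Cconj_conj, !Cconj_RtoC.
replace (Cconj Ci) with (- Ci)%C
  by (unfold Cconj, Ci, Copp; simpl; f_equal; ring).
ring.
Qed.

Lemma base_pos (t z : R) : 0 < t < PI / 2 ->
  0 < 1 - 2 * cos (2 * t) * z ^ 2 + z ^ 4.
Proof.
intros Ht.
assert (Hs : 0 < sin (2 * t)) by (apply sin_gt_0; lra).
pose proof (sin2_cos2 (2 * t)) as H; unfold Rsqr in H.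
replace (1 - 2 * cos (2 * t) * z ^ 2 + z ^ 4)
  with ((z ^ 2 - cos (2 * t)) ^ 2 + sin (2 * t) * sin (2 * t))
  by (rewrite <- H; ring).
pose proof (pow2_ge_0 (z ^ 2 - cos (2 * t))); nra.
Qed.

Lemma psi1_closed_form (t x : R) : 0 < t < PI / 2 ->
  psi1 t x = 2 * sin (2 * t) / (x ^ 4 - 2 * cos (2 * t) * x ^ 2 + 1).
Proof.
intros Ht; pose proof (base_pos t x Ht) as Hb.
set (p := x ^ 2 - cos (2 * t)); set (q := - sin (2 * t)).
assert (E : (RtoC x ^ 2 - expit t ^ 2)%C = (p, q)).
{ unfold p, q; rewrite cos_2a, sin_2a.
  unfold expit, RtoC, Cminus, Cplus, Copp; simpl; unfold Cmult; simpl.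
  f_equal; ring. }
assert (E' : (RtoC x ^ 2 - Cconj (expit t) ^ 2)%C = (p, - q)).
{ unfold p, q; rewrite cos_2a, sin_2a.
  unfold expit, Cconj, RtoC, Cminus, Cplus, Copp; simpl; unfold Cmult; simpl.
  f_equal; ring. }
assert (D : p ^ 2 + q ^ 2 = x ^ 4 - 2 * cos (2 * t) * x ^ 2 + 1).
{ pose proof (sin2_cos2 (2 * t)) as H; unfold Rsqr in H.
  unfold p, q; rewrite <- H; ring. }
unfold psi1, psi1C; rewrite E, E', <- D.
unfold Ci, Cinv, Cminus, Cplus, Copp, Cmult, Re; simpl.
replace (sin (2 * t)) with (- q) by (unfold q; ring).
field; nra.
Qed.

(* Main.v *)
Require Import Defs.
From Stdlib Require Import Reals ZArith Lra Lia.
From Coquelicot Require Import Coquelicot.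
Open Scope R_scope.

(** The function [yinf] solves the equation for the special parameter
[lam_inf] ([is_derive_dyinf]), and it has no zero.  Writing [y = yinf * u] and
[mu = lam - lam_inf] therefore turns the equation into the first-order system
[u' = mu * q0 * v], [v' = q1 * u] with [u 0 = 1] and [v 0 = 0], where [mu * v]
is [yinf^2 * u'].  Solving it by successive substitution gives
[u = sum X^(2n) mu^n] and [v = sum X^(2n+1) mu^n] ([is_derive_Xser]).  The
bound [|X^(n)(x)| <= (K |x|)^n / n!] ([Xnat_bound]) makes both series entire in
[mu] and allows differentiation in [x] term by term ([is_derive_Series]).

At the endpoint [yinf' = yinf / 2] ([dyinf_1]).  This is exactly what cancels
the [u^2] terms in [y^2 - 2 y y'], and leaves [kappa = -2 mu u v]
([kappa_ysol]); its power series is the Cauchy product that defines [acoef].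
All [X^(n)(1)] are positive because [q0] and [q1] are, so [acoef t n < 0] for
[n >= 1].  For [mu > 0] the series of [kappa] and of its derivative have no
positive term, so each is at most its first nonzero term
([PSeries_le_first]): [kappa <= mu * acoef t 1] and [kappa' <= acoef t 1].
This gives the sign statements and the limit.

These formulas concern one explicit solution.  They apply to every solution
because the initial value problem has a unique one, for the derivative as well
as for the function ([is_solution_unique]): the energy [d^2 + d'^2] of the
difference of two solutions grows at most exponentially from zero. *)

(** * Series of functions, integrals and bounds *)

(** If the radius were finite, the terms would not tend to zero at a point beyond it. *)
Lemma CV_radius_entire (a : nat -> R) :
  (forall x, ex_pseries a x) -> CV_radius a = p_infty.
Proof.
intros H.
pose proof (CV_radius_ge_0 a) as H0.
pose proof (CV_disk_outside a) as Hout.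
destruct (CV_radius a) as [c | |]; [exfalso | reflexivity | now destruct H0].
simpl in H0.
apply (Hout (c + 1)).
- simpl. rewrite Rabs_pos_eq; lra.
- apply ex_series_lim_0, ex_pseries_R, H.
Qed.

(** Termwise differentiation: the Weierstrass test, applied to the derivatives on
each ball around the origin, makes their sum converge locally uniformly. *)
Lemma is_derive_Series (f f' : nat -> R -> R) :
  (forall n x, is_derive (f n) x (f' n x)) ->
  (forall x, ex_series (fun n => f n x)) ->
  (forall r : posreal, exists M : nat -> R, ex_series M /\
     forall n x, Rabs x < r -> Rabs (f' n x) <= M n) ->
  forall x, is_derive (fun x => Series (fun n => f n x)) x
                      (Series (fun n => f' n x)).
Proof.
intros Hd Hf HM x.
set (r := mkposreal (Rabs x + 1) ltac:(pose proof (Rabs_pos x); lra)).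
destruct (HM r) as [M [[l Hl] HMb]].
assert (Hpos : forall n, 0 <= M n).
{ intros n. eapply Rle_trans; [apply Rabs_pos | apply (HMb n 0)].
  rewrite Rabs_R0; apply cond_pos. }
assert (HN : CVN_r f' r).
{ exists M, l; split.
  - apply is_series_Reals in Hl.
    intros eps He; destruct (Hl eps He) as [N HNn]; exists N; intros n Hn.
    rewrite (sum_eq _ M) by (intros; apply Rabs_pos_eq, Hpos).
    now apply HNn.
  - intros n y Hy; apply HMb. unfold Boule in Hy. now rewrite Rminus_0_r in Hy. }
destruct (CVN_CVU_r f' r HN x) as [e He]; [simpl; lra |].
apply is_derive_Reals.
apply (CVU_derivable (fun N y => sum_f_R0 (fun n => f n y) N)
         (fun n => SP f' n) _
         (fun y => Series (fun n => f' n y)) x e).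
- exact He.
- intros y _.
  apply is_series_Reals, Series_correct, Hf.
- intros n y _. apply is_derive_Reals. unfold SP.
  induction n as [|n IH]; simpl; [apply Hd |].
  apply (is_derive_plus (V := R_NormedModule)); [exact IH | apply Hd].
- unfold Boule. rewrite Rminus_diag, Rabs_R0. apply cond_pos.
Qed.

(** Both signs of [x] are treated, so that the iterated integrals can be
differentiated at [0] from both sides. *)
Lemma Rabs_RInt_pow_le (f : R -> R) (C : R) (n : nat) (x : R) :
  (forall s, continuous f s) ->
  (forall s, Rabs s <= Rabs x -> Rabs (f s) <= C * Rabs s ^ n) ->
  Rabs (RInt f 0 x) <= C * Rabs x ^ S n / INR (S n).
Proof.
intros Hc Hf.
assert (Hn : INR (S n) <> 0) by (apply not_0_INR; lia).
assert (Hi : forall a b, is_RInt f a b (RInt f a b)).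
{ intros a b. apply (@RInt_correct R_CompleteNormedModule), ex_RInt_continuous.
  intros; apply Hc. }
destruct (Rle_dec 0 x) as [Hx | Hx].
- apply (norm_RInt_le f (fun s => C * s ^ n) 0 x); trivial.
  + intros s Hs. rewrite <- (Rabs_pos_eq s) at 2 by lra.
    apply Hf. rewrite !Rabs_pos_eq; lra.
  + rewrite (Rabs_pos_eq x) by lra.
    replace (C * x ^ S n / INR (S n))
      with (minus (C * x ^ S n / INR (S n)) (C * 0 ^ S n / INR (S n)))
      by (unfold minus, plus, opp; simpl (0 ^ S n); simpl; field; trivial).
    apply (is_RInt_derive (fun s => C * s ^ S n / INR (S n))).
    * intros s _. auto_derive; trivial. simpl pred. field. trivial.
    * intros s _. apply (ex_derive_continuous (fun s => C * s ^ n)). now auto_derive.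
- rewrite <- (opp_RInt_swap f) by (eexists; apply Hi).
  unfold opp; simpl Rabs; rewrite Rabs_Ropp.
  apply (norm_RInt_le f (fun s => C * (- s) ^ n) x 0); trivial; [lra | |].
  + intros s Hs. replace (- s) with (Rabs s) by (apply Rabs_left1; lra).
    apply Hf. rewrite !Rabs_left1; lra.
  + rewrite (Rabs_left1 x) by lra.
    replace (C * (- x) ^ S n / INR (S n))
      with (minus (- (C * (- 0) ^ S n / INR (S n))) (- (C * (- x) ^ S n / INR (S n))))
      by (unfold minus, plus, opp; rewrite Ropp_0; simpl (0 ^ S n); simpl; field; trivial).
    apply (is_RInt_derive (fun s => - (C * (- s) ^ S n / INR (S n)))).
    * intros s _. auto_derive; trivial. simpl pred. field. trivial.
    * intros s _. apply (ex_derive_continuous (fun s => C * (- s) ^ n)). now auto_derive.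
Qed.

Lemma bounded_on_ball (f : R -> R) (r : R) :
  0 <= r -> (forall x, continuous f x) ->
  exists K, forall x, Rabs x <= r -> Rabs (f x) <= K.
Proof.
intros Hr Hf.
destruct (continuity_ab_maj (fun x => Rabs (f x)) (- r) r) as [m [Hm _]]; [lra | |].
- intros c _. apply continuity_pt_filterlim.
  apply (continuous_comp f Rabs); [apply Hf | apply continuous_Rabs].
- exists (Rabs (f m)); intros x Hx; apply Hm. now apply Rabs_le_between.
Qed.

Lemma PSeries_le_first (a : nat -> R) (x : R) :
  0 <= x -> (forall n, a n <= 0) -> ex_pseries a x -> PSeries a x <= a 0%nat.
Proof.
intros Hx Ha Hex. apply ex_pseries_R in Hex.
unfold PSeries. rewrite Series_incr_1 by trivial.
assert (H : 0 <= Series (fun n => - (a (S n) * x ^ S n))).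
{ rewrite <- (Rmult_0_l (Series (fun n => - (a (S n) * x ^ S n)))),
    <- Series_scal_l.
  apply Series_le.
  - intros n; pose proof (Ha (S n)); pose proof (pow_le x (S n) Hx); nra.
  - apply (ex_series_opp (V := R_NormedModule)).
    now apply (ex_series_incr_1 (fun n => a n * x ^ n)). }
rewrite Series_opp in H. rewrite pow_O; lra.
Qed.

(** * The solution at the special parameter *)

Definition dyinf (t z : R) : R :=
  yinf t z * ((z ^ 3 - cos (2 * t) * z) / (1 - 2 * cos (2 * t) * z ^ 2 + z ^ 4)).

Lemma psi0_closed_form (t x : R) : 0 < t < PI / 2 ->
  psi0 t x = 3 / 2 * (cos (2 * t) * x ^ 4 - 2 * x ^ 2 + cos (2 * t)) /
             (1 - 2 * cos (2 * t) * x ^ 2 + x ^ 4) ^ 2.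
Proof.
intros Ht; pose proof (base_pos t x Ht) as Hb.
pose proof (sin2_cos2 (2 * t)) as H; unfold Rsqr in H.
set (c := cos (2 * t)) in *; set (s := sin (2 * t)) in *.
set (p := x ^ 2 - c).
assert (Ea : (expit t ^ 2)%C = (c, s)).
{ unfold c, s; rewrite cos_2a, sin_2a.
  unfold expit, RtoC; simpl; unfold Cmult; simpl. f_equal; ring. }
assert (Eb : (Cconj (expit t) ^ 2)%C = (c, - s)).
{ unfold c, s; rewrite cos_2a, sin_2a.
  unfold expit, Cconj, RtoC; simpl; unfold Cmult; simpl. f_equal; ring. }
assert (E : (RtoC x ^ 2 - (c, s))%C = (p, - s)).
{ unfold p, RtoC, Cminus, Cplus, Copp; simpl; unfold Cmult; simpl.
  f_equal; ring. }
assert (E' : (RtoC x ^ 2 - (c, (- s)%R))%C = (p, s)).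
{ unfold p, RtoC, Cminus, Cplus, Copp; simpl; unfold Cmult; simpl.
  f_equal; ring. }
assert (D : 1 - 2 * c * x ^ 2 + x ^ 4 = p ^ 2 + s ^ 2)
  by (unfold p; rewrite <- H; ring).
(* The numerator is rewritten as the real part of [(c + i s) (p + i s)^2]. *)
replace (3 / 2 * (c * x ^ 4 - 2 * x ^ 2 + c))
  with (3 / 2 * (c * p ^ 2 - 2 * s ^ 2 * p - c * s ^ 2)).
2: { unfold p. replace (s ^ 2) with (1 - c * c) by (rewrite <- H; ring). ring. }
rewrite D in *.
unfold psi0, psi0C; rewrite Ea, Eb, E, E'.
unfold Cdiv, Cinv, Cplus, Cmult, RtoC, Re; simpl; unfold Cmult, RtoC; simpl.
field; split; nra.
Qed.

Lemma yinf_pos (t z : R) : 0 < yinf t z.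
Proof. apply exp_pos. Qed.

Lemma is_derive_yinf (t z : R) : 0 < t < PI / 2 ->
  is_derive (yinf t) z (dyinf t z).
Proof.
intros Ht; pose proof (base_pos t z Ht) as Hb.
unfold dyinf, yinf, Rpower. auto_derive.
- lra.
- replace (1 + - (2 * cos (2 * t) * (z * (z * 1))) + z * (z * (z * (z * 1))))
    with (1 - 2 * cos (2 * t) * z ^ 2 + z ^ 4) by ring.
  field. lra.
Qed.

(** With [P = 1 - 2 c z^2 + z^4] and [c = cos 2t], one has [yinf = P^(1/4)] and
[(yinf'' / yinf + psi0) P^2 = (c / 2) P], while [psi1 = 2 sin (2t) / P]: the
ratio is the constant [lam_inf]. *)
Lemma is_derive_dyinf (t z : R) : 0 < t < PI / 2 ->
  is_derive (dyinf t) z ((lam_inf t * psi1 t z - psi0 t z) * yinf t z).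
Proof.
intros Ht; pose proof (base_pos t z Ht) as Hb.
pose proof (is_derive_yinf t z Ht) as Hy.
assert (Hs : 0 < sin (2 * t)) by (apply sin_gt_0; lra).
rewrite psi0_closed_form, psi1_closed_form by trivial.
unfold dyinf at 1. auto_derive.
- split; [now exists (dyinf t z) | split; [lra | trivial]].
- replace (Derive (fun x => yinf t x) z) with (dyinf t z)
    by (symmetry; apply is_derive_unique, Hy).
  unfold dyinf, lam_inf. field. split; lra.
Qed.

(** At [z = 1] the numerator [1 - c] of the logarithmic derivative is half of
[P = 2 - 2 c]. *)
Lemma dyinf_1 (t : R) : 0 < t < PI / 2 -> dyinf t 1 = yinf t 1 / 2.
Proof.
intros Ht; pose proof (base_pos t 1 Ht).
unfold dyinf. field. lra.
Qed.

(** * The iterated integrals *)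

Lemma q0_pos (t z : R) : 0 < q0 t z.
Proof.
unfold q0. apply Rdiv_lt_0_compat; [lra | apply pow_lt, yinf_pos].
Qed.

Lemma q1_pos (t z : R) : 0 < t < PI / 2 -> 0 < q1 t z.
Proof.
intros Ht; pose proof (base_pos t z Ht) as Hb.
assert (Hs : 0 < sin (2 * t)) by (apply sin_gt_0; lra).
unfold q1. rewrite psi1_closed_form by trivial.
apply Rmult_lt_0_compat; [apply Rdiv_lt_0_compat; lra | apply pow_lt, yinf_pos].
Qed.

Lemma continuous_psi0 (t z : R) : 0 < t < PI / 2 -> continuous (psi0 t) z.
Proof.
intros Ht; pose proof (base_pos t z Ht) as Hb.
eapply continuous_ext; [intros; symmetry; now apply psi0_closed_form |].
apply (ex_derive_continuous (V := R_NormedModule)). auto_derive.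
apply Rgt_not_eq. nra.
Qed.

Lemma continuous_psi1 (t z : R) : 0 < t < PI / 2 -> continuous (psi1 t) z.
Proof.
intros Ht; pose proof (base_pos t z Ht) as Hb.
eapply continuous_ext; [intros; symmetry; now apply psi1_closed_form |].
apply (ex_derive_continuous (V := R_NormedModule)). auto_derive.
lra.
Qed.

(** The weight integrated against at the [n]-th step; the parity test is that of
[Xnat], so [weight t (S n)] is the density of [Xnat t (S n)]. *)
Definition weight (t : R) (n : nat) : R -> R :=
  if Nat.odd n then q1 t else q0 t.

Lemma weight_pos (t : R) (n : nat) (z : R) : 0 < t < PI / 2 -> 0 < weight t n z.
Proof.
intros Ht. unfold weight. destruct (Nat.odd n); [now apply q1_pos | apply q0_pos].
Qed.

Lemma continuous_weight (t : R) (n : nat) (z : R) :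
  0 < t < PI / 2 -> continuous (weight t n) z.
Proof.
intros Ht.
assert (Hy : ex_derive (fun x => yinf t x) z)
  by (eexists; now apply is_derive_yinf).
unfold weight. destruct (Nat.odd n).
- apply (continuous_mult (K := R_AbsRing)); [now apply continuous_psi1 |].
  apply (ex_derive_continuous (V := R_NormedModule)). now auto_derive.
- apply (ex_derive_continuous (V := R_NormedModule)). unfold q0. auto_derive.
  repeat split; trivial. apply Rgt_not_eq, (pow_lt _ 2), yinf_pos.
Qed.

Lemma Xnat_S (t : R) (n : nat) (z : R) :
  Xnat t (S n) z = RInt (fun s => Xnat t n s * weight t (S n) s) 0 z.
Proof.
simpl. apply RInt_ext; intros s _. unfold weight.
now destruct (Nat.odd (S n)).
Qed.

Lemma continuous_Xnat (t : R) (n : nat) (z : R) :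
  0 < t < PI / 2 -> continuous (Xnat t n) z.
Proof.
intros Ht. revert z; induction n as [|n IH]; intros z.
- apply continuous_const.
- eapply continuous_ext; [intros; symmetry; apply Xnat_S |].
  apply (ex_derive_continuous (V := R_NormedModule)).
  eexists. apply is_derive_RInt with 0.
  + apply filter_forall; intros x.
    apply (RInt_correct (V := R_CompleteNormedModule)), ex_RInt_continuous.
    intros s _. apply (continuous_mult (K := R_AbsRing)); [apply IH | now apply continuous_weight].
  + apply (continuous_mult (K := R_AbsRing)); [apply IH | now apply continuous_weight].
Qed.

Lemma continuous_Xnat_weight (t : R) (n m : nat) (z : R) :
  0 < t < PI / 2 -> continuous (fun s => Xnat t n s * weight t m s) z.
Proof.
intros Ht. apply (continuous_mult (K := R_AbsRing));
  [now apply continuous_Xnat | now apply continuous_weight].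
Qed.

Lemma is_derive_Xnat (t : R) (n : nat) (z : R) : 0 < t < PI / 2 ->
  is_derive (Xnat t (S n)) z (Xnat t n z * weight t (S n) z).
Proof.
intros Ht.
eapply is_derive_ext; [intros; symmetry; apply Xnat_S |].
apply (is_derive_RInt (fun s => Xnat t n s * weight t (S n) s)) with 0.
- apply filter_forall; intros x.
  apply (RInt_correct (V := R_CompleteNormedModule)), ex_RInt_continuous.
  intros s _. now apply continuous_Xnat_weight.
- now apply continuous_Xnat_weight.
Qed.

Lemma Xnat_pos (t : R) (n : nat) (z : R) :
  0 < t < PI / 2 -> 0 < z -> 0 < Xnat t n z.
Proof.
intros Ht. revert z; induction n as [|n IH]; intros z Hz; [simpl; lra |].
rewrite Xnat_S. apply RInt_gt_0; trivial.
- intros s Hs. apply Rmult_lt_0_compat; [apply IH; lra | now apply weight_pos].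
- intros s _. now apply continuous_Xnat_weight.
Qed.

(** The factorial comes from the [n] nested integrations of powers of [|z|]. *)
Lemma Xnat_bound (t r K : R) : 0 < t < PI / 2 ->
  (forall n s, Rabs s <= r -> Rabs (weight t n s) <= K) ->
  forall n z, Rabs z <= r -> Rabs (Xnat t n z) <= K ^ n / INR (fact n) * Rabs z ^ n.
Proof.
intros Ht HK n; induction n as [|n IH]; intros z Hz.
- simpl. rewrite Rabs_R1. lra.
- rewrite Xnat_S.
  replace (K ^ S n / INR (fact (S n)) * Rabs z ^ S n)
    with (K ^ S n / INR (fact n) * Rabs z ^ S n / INR (S n)).
  2: { rewrite fact_simpl, mult_INR. field.
       split; [apply INR_fact_neq_0 | apply not_0_INR; lia]. }
  apply Rabs_RInt_pow_le; [intros; now apply continuous_Xnat_weight |].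
  intros s Hs. rewrite Rabs_mult.
  replace (K ^ S n / INR (fact n) * Rabs s ^ n)
    with (K ^ n / INR (fact n) * Rabs s ^ n * K)
    by (simpl; field; apply INR_fact_neq_0).
  apply Rmult_le_compat; try apply Rabs_pos; [apply IH | apply HK]; lra.
Qed.

Lemma weight_bound (t r : R) : 0 < t < PI / 2 -> 0 <= r ->
  exists K, 0 <= K /\ forall n s, Rabs s <= r -> Rabs (weight t n s) <= K.
Proof.
intros Ht Hr.
destruct (bounded_on_ball (weight t 0) r) as [K0 H0]; trivial;
  [intros; now apply continuous_weight |].
destruct (bounded_on_ball (weight t 1) r) as [K1 H1]; trivial;
  [intros; now apply continuous_weight |].
exists (Rmax K0 K1); split.
- apply Rle_trans with K0; [| apply Rmax_l].
  eapply Rle_trans; [apply Rabs_pos | apply (H0 0)]. now rewrite Rabs_R0.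
- intros n s Hs. unfold weight. destruct (Nat.odd n).
  + eapply Rle_trans; [now apply H1 | apply Rmax_r].
  + eapply Rle_trans; [now apply H0 | apply Rmax_l].
Qed.

(** Passing to every second iterated integral costs nothing:
[(e + 2n)! >= n!], so an exponential series in [(K r)^2 |mu|] dominates,
where [K] bounds the weights on the ball of radius [r]. *)
Lemma Xnat_terms_dominated (t : R) (e : nat) (mu r : R) :
  0 < t < PI / 2 -> 0 <= r ->
  exists M : nat -> R, ex_series M /\
    forall n x, Rabs x <= r -> Rabs (Xnat t (e + 2 * n) x * mu ^ n) <= M n.
Proof.
intros Ht Hr.
destruct (weight_bound t r Ht Hr) as [K [HK0 HK]].
set (B := K * r).
assert (HB : 0 <= B) by (unfold B; nra).
exists (fun n => B ^ e * (/ INR (fact n) * (B ^ 2 * Rabs mu) ^ n)); split.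
- apply (ex_series_scal_l (B ^ e) (fun n => / INR (fact n) * (B ^ 2 * Rabs mu) ^ n)).
  apply (ex_pseries_R (fun n => / INR (fact n))). eexists; apply is_exp_Reals.
- intros n x Hx. rewrite Rabs_mult, <- RPow_abs.
  rewrite Rpow_mult_distr, <- pow_mult.
  replace (B ^ e * (/ INR (fact n) * (B ^ (2 * n) * Rabs mu ^ n)))
    with (B ^ (e + 2 * n) / INR (fact n) * Rabs mu ^ n)
    by (rewrite pow_add; unfold Rdiv; ring).
  apply Rmult_le_compat_r; [apply pow_le, Rabs_pos |].
  eapply Rle_trans; [now apply (Xnat_bound t r K) |].
  unfold B. rewrite Rpow_mult_distr. unfold Rdiv.
  rewrite (Rmult_assoc (K ^ _)), (Rmult_comm (/ _)), <- Rmult_assoc.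
  apply Rmult_le_compat.
  + apply Rmult_le_pos; apply pow_le; trivial. apply Rabs_pos.
  + apply Rlt_le, Rinv_0_lt_compat, INR_fact_lt_0.
  + apply Rmult_le_compat_l; [now apply pow_le |].
    apply pow_incr; split; [apply Rabs_pos | trivial].
  + apply Rinv_le_contravar; [apply INR_fact_lt_0 |].
    apply le_INR, fact_le. lia.
Qed.

(** * The generating series of the iterated integrals *)

(** [Xser t 0] is [u] and [Xser t 1] is [v]; a general offset [e] lets one
differentiation rule serve both, since [u = 1 + mu * Xser t 2] ([Xser_0]). *)
Definition Xser (t : R) (e : nat) (mu x : R) : R :=
  PSeries (fun n => Xnat t (e + 2 * n) x) mu.

Lemma ex_pseries_Xnat (t : R) (e : nat) (x mu : R) : 0 < t < PI / 2 ->
  ex_pseries (fun n => Xnat t (e + 2 * n) x) mu.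
Proof.
intros Ht. apply ex_pseries_R.
destruct (Xnat_terms_dominated t e mu (Rabs x) Ht (Rabs_pos x)) as [M [HM Hb]].
apply (ex_series_le (V := R_CompleteNormedModule)) with M; trivial.
intros n. apply (Hb n x). lra.
Qed.

(** Every term of the series has an index of the same parity, hence the same
weight, which therefore factors out of the differentiated series. *)
Lemma is_derive_Xser (t : R) (e : nat) (mu x : R) : 0 < t < PI / 2 ->
  is_derive (Xser t (S e) mu) x (Xser t e mu x * weight t (S e) x).
Proof.
intros Ht. unfold Xser, PSeries.
rewrite <- Series_scal_r.
apply (is_derive_Series (fun n x => Xnat t (S e + 2 * n) x * mu ^ n)
         (fun n x => Xnat t (e + 2 * n) x * mu ^ n * weight t (S e) x)).
- intros n z.
  replace (Xnat t (e + 2 * n) z * mu ^ n * weight t (S e) z)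
    with (Xnat t (e + 2 * n) z * weight t (S (e + 2 * n)) z * mu ^ n).
  2: { replace (weight t (S (e + 2 * n))) with (weight t (S e)); [ring |].
       unfold weight. change (S (e + 2 * n)) with (S e + 2 * n)%nat.
       now rewrite Nat.odd_add_mul_2. }
  apply (is_derive_scal_l (V := R_NormedModule) (Xnat t (S e + 2 * n))).
  apply is_derive_Xnat, Ht.
- intros z. apply ex_pseries_R, ex_pseries_Xnat, Ht.
- intros r. pose proof (cond_pos r) as Hr.
  destruct (Xnat_terms_dominated t e mu r Ht) as [M [HM HMb]]; [lra |].
  destruct (weight_bound t r Ht) as [K [HK0 HK]]; [lra |].
  exists (fun n => M n * K); split; [now apply ex_series_scal_r |].
  intros n z Hz. rewrite Rabs_mult.
  apply Rmult_le_compat; try apply Rabs_pos; [apply HMb | apply HK]; lra.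
Qed.

Lemma Xser_0 (t mu x : R) : 0 < t < PI / 2 ->
  Xser t 0 mu x = 1 + mu * Xser t 2 mu x.
Proof.
intros Ht. unfold Xser. rewrite PSeries_decr_1 by now apply ex_pseries_Xnat.
f_equal. f_equal. apply PSeries_ext. intros n. unfold PS_decr_1.
now replace (0 + 2 * S n)%nat with (2 + 2 * n)%nat by lia.
Qed.

Lemma Xser_S_0 (t : R) (e : nat) (mu : R) : Xser t (S e) mu 0 = 0.
Proof.
unfold Xser, PSeries.
rewrite (Series_ext _ (fun n => 0 * Xnat t (S e + 2 * n) 0)).
- rewrite Series_scal_l. ring.
- intros n. change (S e + 2 * n)%nat with (S (e + 2 * n)).
  rewrite Xnat_S, RInt_point. unfold zero; simpl. ring.
Qed.

(** * Uniqueness for the initial value problem *)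

Lemma is_derive_D_in (f df : R -> R) (D : R -> Prop) (x : R) :
  is_derive f x (df x) -> D_in f df D x.
Proof.
intros H. apply is_derive_Reals, derivable_pt_lim_D_in in H.
apply limit1_imp with (2 := H). intros y [_ Hy]. now split.
Qed.

Lemma D_in_interior (f df : R -> R) (x : R) :
  0 < x < 1 -> D_in f df I01 x -> is_derive f x (df x).
Proof.
intros Hx H. apply is_derive_Reals. intros eps He.
destruct (H eps He) as [a [Ha Hlim]].
assert (Hd : 0 < Rmin a (Rmin x (1 - x))) by (repeat apply Rmin_pos; lra).
exists (mkposreal _ Hd); simpl; intros h Hh0 Hh.
pose proof (Rmin_l a (Rmin x (1 - x))); pose proof (Rmin_r a (Rmin x (1 - x))).
pose proof (Rmin_l x (1 - x)); pose proof (Rmin_r x (1 - x)).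
apply Rabs_def2 in Hh as Hh'.
specialize (Hlim (x + h)). simpl in Hlim. unfold Rdist in Hlim.
replace (x + h - x) with h in Hlim by ring.
apply Hlim. split; [split; [unfold I01; lra | lra] | lra].
Qed.

(** The retraction of the line onto [[0,1]].  A function with one-sided derivatives
at the endpoints becomes continuous on the whole line when precomposed with it,
as the mean value theorem demands. *)
Definition clamp (x : R) : R := Rmax 0 (Rmin 1 x).

Lemma clamp_id (x : R) : I01 x -> clamp x = x.
Proof. intros [H0 H1]. unfold clamp. rewrite Rmin_right, Rmax_right; lra. Qed.

Lemma clamp_I01 (x : R) : I01 (clamp x).
Proof. unfold clamp, I01, Rmax, Rmin. repeat destruct (Rle_dec _ _); lra. Qed.

Lemma clamp_lipschitz (x y : R) : Rabs (clamp x - clamp y) <= Rabs (x - y).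
Proof.
unfold clamp, Rmax, Rmin, Rabs.
repeat destruct (Rle_dec _ _); repeat destruct (Rcase_abs _); lra.
Qed.

Lemma D_in_nonincreasing (f df : R -> R) :
  (forall x, I01 x -> D_in f df I01 x) -> (forall x, I01 x -> df x <= 0) ->
  forall x, I01 x -> f x <= f 0.
Proof.
intros Hf Hdf x Hx.
destruct (MVT_gen (fun y => f (clamp y)) 0 x df) as [c [Hc E]].
- rewrite Rmin_left, Rmax_right by apply Hx. intros y Hy.
  assert (Hy' : 0 < y < 1) by (unfold I01 in Hx; lra).
  apply is_derive_ext_loc with f; [| now apply D_in_interior, Hf; [| unfold I01; lra]].
  apply (locally_interval _ y 0 1); simpl; try lra.
  intros z Hz0 Hz1. simpl in *. rewrite clamp_id; [reflexivity | unfold I01; lra].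
- intros y _ eps He.
  destruct (cont_deriv _ _ _ _ (Hf _ (clamp_I01 y)) eps He) as [a [Ha Hlim]].
  exists a; split; [exact Ha |]. intros z [_ Hz]. simpl in *. unfold Rdist in *.
  destruct (Req_dec (clamp y) (clamp z)) as [-> | Hne].
  + rewrite Rminus_diag, Rabs_R0. exact He.
  + apply Hlim. split; [split; [apply clamp_I01 | exact Hne] |].
    eapply Rle_lt_trans; [apply clamp_lipschitz | exact Hz].
- rewrite Rmin_left, Rmax_right in Hc by apply Hx.
  rewrite !clamp_id in E by (unfold I01 in *; lra).
  unfold I01 in Hx.
  assert (df c <= 0) by (apply Hdf; unfold I01; lra). nra.
Qed.

(** With [E = d^2 + e^2], [E' = 2 (1 + V) d e <= (1 + K) E], so
[exp (- (1 + K) x) E] does not increase from its initial value [0]. *)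
Lemma linear_ode_zero (V d e : R -> R) (K : R) :
  (forall x, I01 x -> Rabs (V x) <= K) ->
  (forall x, I01 x -> D_in d e I01 x) ->
  (forall x, I01 x -> D_in e (fun s => V s * d s) I01 x) ->
  d 0 = 0 -> e 0 = 0 ->
  forall x, I01 x -> d x = 0 /\ e x = 0.
Proof.
intros HV Hd He Hd0 He0 x Hx.
set (E := fun s => d s * d s + e s * e s).
set (g := fun s => exp (- (1 + K) * s)).
assert (Hle : g x * E x <= g 0 * E 0).
{ apply (D_in_nonincreasing (fun s => g s * E s)
    (fun s => (- (1 + K) * g s) * E s +
       g s * ((e s * d s + d s * e s) + (V s * d s * e s + e s * (V s * d s)))));
    trivial.
  - intros s Hs. apply Dmult.
    + apply is_derive_D_in. unfold g. auto_derive; [trivial | ring].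
    + apply Dadd; apply Dmult; auto.
  - intros s Hs. pose proof (HV s Hs) as Hb. apply Rabs_le_between in Hb.
    assert (Hg : 0 < g s) by apply exp_pos.
    (* The sign of [1 + V s] decides which square, [(d - e)^2] or [(d + e)^2],
       bounds [2 (1 + V) d e]. *)
    assert (2 * (d s * e s) + 2 * V s * (d s * e s) <= (1 + K) * E s);
      [| nra].
    unfold E.
    destruct (Rle_dec 0 (1 + V s)).
    + assert (0 <= (1 + V s) * (d s - e s) ^ 2)
        by (apply Rmult_le_pos; [lra | apply pow2_ge_0]).
      assert (0 <= (K - V s) * (d s ^ 2 + e s ^ 2))
        by (apply Rmult_le_pos; [lra |]; pose proof (pow2_ge_0 (d s));
            pose proof (pow2_ge_0 (e s)); lra).
      nra.
    + assert (0 <= (- (1 + V s)) * (d s + e s) ^ 2)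
        by (apply Rmult_le_pos; [lra | apply pow2_ge_0]).
      assert (0 <= (2 + K + V s) * (d s ^ 2 + e s ^ 2))
        by (apply Rmult_le_pos; [lra |]; pose proof (pow2_ge_0 (d s));
            pose proof (pow2_ge_0 (e s)); lra).
      nra. }
assert (Hg : 0 < g x) by apply exp_pos.
unfold E in Hle at 2. rewrite Hd0, He0 in Hle.
assert (HE : E x <= 0) by nra.
unfold E in HE. split; nra.
Qed.

Lemma is_solution_unique (t lam : R) (y dy z dz : R -> R) : 0 < t < PI / 2 ->
  is_solution t lam y dy -> is_solution t lam z dz ->
  forall x, I01 x -> z x = y x /\ dz x = dy x.
Proof.
intros Ht [Hy0 [Hdy0 [ddy Hy]]] [Hz0 [Hdz0 [ddz Hz]]] x Hx.
destruct (bounded_on_ball (fun s => lam * psi1 t s - psi0 t s) 1) as [K HK]; [lra | |].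
{ intros s. apply (continuous_minus (V := R_NormedModule)).
  - apply (continuous_scal_r (V := R_NormedModule) lam), continuous_psi1, Ht.
  - apply continuous_psi0, Ht. }
destruct (linear_ode_zero (fun s => lam * psi1 t s - psi0 t s)
  (fun s => z s - y s) (fun s => dz s - dy s) K) with x as [E1 E2]; trivial; try lra.
- intros s [Hs0 Hs1]. apply HK. rewrite Rabs_pos_eq; lra.
- intros s Hs. apply Dminus; [apply Hz | apply Hy]; exact Hs.
- intros s Hs.
  destruct (Hy s Hs) as [_ [D1 F1]]; destruct (Hz s Hs) as [_ [D2 F2]].
  pose proof (Dminus _ _ _ _ _ _ D2 D1) as D.
  unfold D_in in *.
  replace ((lam * psi1 t s - psi0 t s) * (z s - y s)) with (ddz s - ddy s) by lra.
  exact D.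
Qed.

(** * The solution for a general parameter *)

Definition ysol (t lam x : R) : R := yinf t x * Xser t 0 (lam - lam_inf t) x.

Definition dysol (t lam x : R) : R :=
  dyinf t x * Xser t 0 (lam - lam_inf t) x +
  (lam - lam_inf t) * Xser t 1 (lam - lam_inf t) x / yinf t x.

(** In the second derivative of [yinf * u] the two terms that contain [yinf' * v]
cancel, since [yinf * u' = mu * v / yinf]. *)
Lemma is_solution_ysol (t lam : R) : 0 < t < PI / 2 ->
  is_solution t lam (ysol t lam) (dysol t lam).
Proof.
intros Ht. unfold ysol, dysol. set (mu := lam - lam_inf t).
assert (Hu : forall x, is_derive (fun s => Xser t 0 mu s) x (mu * (Xser t 1 mu x * q0 t x))).
{ intros x. eapply is_derive_ext; [intros; symmetry; now apply Xser_0 |].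
  pose proof (is_derive_Xser t 1 mu x Ht) as H.
  change (weight t 2 x) with (q0 t x) in H.
  rewrite <- (Rplus_0_l (mu * _)).
  apply (is_derive_plus (V := R_NormedModule)); [apply (is_derive_const (V := R_NormedModule)) |].
  now apply is_derive_scal. }
assert (Hv : forall x, is_derive (fun s => Xser t 1 mu s) x (Xser t 0 mu x * q1 t x))
  by (intros x; exact (is_derive_Xser t 0 mu x Ht)).
split; [| split].
- rewrite Xser_0, Xser_S_0 by trivial. unfold yinf.
  replace (1 - 2 * cos (2 * t) * 0 ^ 2 + 0 ^ 4) with 1 by ring.
  unfold Rpower. rewrite ln_1, Rmult_0_r, exp_0. ring.
- rewrite Xser_S_0. unfold dyinf, Rdiv. ring.
- exists (fun x => (lam * psi1 t x - psi0 t x) * (yinf t x * Xser t 0 mu x)).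
  intros x _.
  pose proof (is_derive_yinf t x Ht) as Hy.
  pose proof (is_derive_dyinf t x Ht) as Hdy.
  pose proof (yinf_pos t x) as Hp.
  assert (Ey : Derive (fun x => yinf t x) x = dyinf t x) by now apply is_derive_unique.
  assert (Edy : Derive (fun x => dyinf t x) x =
    (lam_inf t * psi1 t x - psi0 t x) * yinf t x) by now apply is_derive_unique.
  assert (Eu : Derive (fun s => Xser t 0 mu s) x = mu * (Xser t 1 mu x * q0 t x))
    by now apply is_derive_unique.
  assert (Ev : Derive (fun s => Xser t 1 mu s) x = Xser t 0 mu x * q1 t x)
    by now apply is_derive_unique.
  split; [| split].
  + apply is_derive_D_in. auto_derive.
    * repeat split; trivial; eexists; eauto.
    * rewrite Ey, Eu. unfold q0. field. lra.
  + apply is_derive_D_in. auto_derive.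
    * repeat split; trivial; try (eexists; now eauto). lra.
    * rewrite Ey, Edy, Eu, Ev. unfold q0, q1.
      replace lam with (lam_inf t + mu) by (unfold mu; ring). field. lra.
  + ring.
Qed.

(** * The power series of kappa *)

Lemma Xtilde_even (t x : R) (k : nat) : Xtilde t (2 * Z.of_nat k) x = Xnat t (2 * k) x.
Proof.
unfold Xtilde. destruct (Z.ltb_spec (2 * Z.of_nat k) 0); [lia |].
f_equal. lia.
Qed.

(** The value [0] at index [-1] is the constant term of the shifted series
[mu * v]. *)
Lemma Xtilde_odd (t x : R) (k : nat) :
  Xtilde t (2 * Z.of_nat k - 1) x = PS_incr_1 (fun n => Xnat t (1 + 2 * n) x) k.
Proof.
unfold Xtilde. destruct k as [|k]; [reflexivity |].
destruct (Z.ltb_spec (2 * Z.of_nat (S k) - 1) 0); [lia |].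
unfold PS_incr_1. f_equal. lia.
Qed.

Lemma acoef_PS_mult (t : R) (n : nat) :
  acoef t n = PS_scal (-2) (PS_mult (fun k => Xnat t (0 + 2 * k) 1)
                         (PS_incr_1 (fun k => Xnat t (1 + 2 * k) 1))) n.
Proof.
unfold acoef, PS_scal, PS_mult. change (scal (-2)) with (Rmult (-2)).
f_equal. apply sum_eq. intros k Hk.
rewrite Xtilde_even, <- Nat2Z.inj_sub, Xtilde_odd by trivial. reflexivity.
Qed.

Lemma acoef_0 (t : R) : acoef t 0 = 0.
Proof.
unfold acoef; simpl. unfold Xtilde at 2; simpl. ring.
Qed.

(** The summand [k = n] contains the index [-1] and vanishes; the others are
positive, and there is at least one. *)
Lemma acoef_neg (t : R) (n : nat) : 0 < t < PI / 2 -> (1 <= n)%nat -> acoef t n < 0.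
Proof.
intros Ht Hn. destruct n as [|n]; [lia |].
rewrite acoef_PS_mult. unfold PS_scal. change (scal (-2)) with (Rmult (-2)).
unfold PS_mult. rewrite tech5, Nat.sub_diag.
assert (0 < sum_f_R0 (fun k => Xnat t (0 + 2 * k) 1 *
    PS_incr_1 (fun k => Xnat t (1 + 2 * k) 1) (S n - k)) n).
{ rewrite (sum_eq _ (fun k => Xnat t (0 + 2 * k) 1 * Xnat t (1 + 2 * (n - k)) 1)).
  - assert (Hp : forall k, 0 < Xnat t (0 + 2 * k) 1 * Xnat t (1 + 2 * (n - k)) 1)
      by (intros k; apply Rmult_lt_0_compat; apply Xnat_pos; lra).
    generalize n at 2. intros m. induction m as [|m IH]; simpl sum_f_R0; [apply (Hp 0%nat) |].
    pose proof (Hp (S m)). simpl in *. lra.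
  - intros k Hk. now rewrite Nat.sub_succ_l by trivial. }
simpl PS_incr_1 at 2. change zero with 0. lra.
Qed.

Lemma is_pseries_acoef (t mu : R) : 0 < t < PI / 2 ->
  is_pseries (acoef t) mu (-2 * (mu * Xser t 0 mu 1 * Xser t 1 mu 1)).
Proof.
intros Ht.
assert (R0 : CV_radius (fun k => Xnat t (0 + 2 * k) 1) = p_infty)
  by (apply CV_radius_entire; intros; now apply ex_pseries_Xnat).
assert (R1 : CV_radius (PS_incr_1 (fun k => Xnat t (1 + 2 * k) 1)) = p_infty)
  by (rewrite CV_radius_incr_1; apply CV_radius_entire; intros; now apply ex_pseries_Xnat).
eapply is_pseries_ext; [intros; symmetry; apply acoef_PS_mult |].
apply (is_pseries_scal (V := R_NormedModule)); [apply Rmult_comm |].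
replace (mu * Xser t 0 mu 1 * Xser t 1 mu 1)
  with (Xser t 0 mu 1 * (mu * Xser t 1 mu 1)) by ring.
apply is_pseries_mult.
- now apply PSeries_correct, ex_pseries_Xnat.
- apply (is_pseries_incr_1 (V := R_NormedModule)).
  now apply PSeries_correct, ex_pseries_Xnat.
- now rewrite R0.
- now rewrite R1.
Qed.

Lemma kappa_ysol (t lam : R) : 0 < t < PI / 2 ->
  let mu := lam - lam_inf t in
  ysol t lam 1 ^ 2 - 2 * ysol t lam 1 * dysol t lam 1 =
  -2 * (mu * Xser t 0 mu 1 * Xser t 1 mu 1).
Proof.
intros Ht mu. unfold ysol, dysol; fold mu. rewrite dyinf_1 by trivial.
pose proof (yinf_pos t 1). field. lra.
Qed.

Theorem mainTheorem3 :
  forall t : R, 0 < t < PI / 2 ->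
  (* the solution exists and is unique for each lam *)
  (forall lam : R,
     exists y dy : R -> R, is_solution t lam y dy /\
       forall z dz : R -> R, is_solution t lam z dz ->
         forall x : R, I01 x -> z x = y x) /\
  forall y dy : R -> R -> R,
  (forall lam : R, is_solution t lam (y lam) (dy lam)) ->
  let kappa := fun lam : R => y lam 1 ^ 2 - 2 * y lam 1 * dy lam 1 in
  (forall lam : R, is_pseries (acoef t) (lam - lam_inf t) (kappa lam)) /\
  acoef t 0 = 0 /\
  (forall n : nat, (1 <= n)%nat -> acoef t n < 0) /\
  (forall lam : R, lam_inf t < lam ->
     kappa lam <> 0 /\ ex_derive kappa lam /\ Derive kappa lam < 0) /\
  is_lim kappa p_infty m_infty.
Proof.
intros t Ht. split.
{ intros lam. exists (ysol t lam), (dysol t lam).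
  split; [now apply is_solution_ysol |]. intros z dz Hz x Hx.
  refine (proj1 (is_solution_unique t lam _ _ z dz Ht _ Hz x Hx)).
  now apply is_solution_ysol. }
intros y dy Hsol kappa.
assert (Hk : forall lam, is_pseries (acoef t) (lam - lam_inf t) (kappa lam)).
{ intros lam.
  destruct (is_solution_unique t lam (ysol t lam) (dysol t lam) (y lam) (dy lam))
    with 1 as [E1 E2]; trivial; [now apply is_solution_ysol | unfold I01; lra |].
  unfold kappa. rewrite E1, E2, kappa_ysol by trivial.
  now apply is_pseries_acoef. }
assert (Hneg : forall n, (1 <= n)%nat -> acoef t n < 0)
  by (intros n; now apply acoef_neg).
assert (HR : CV_radius (acoef t) = p_infty).
{ apply CV_radius_entire. intros mu. eexists. now apply is_pseries_acoef. }
assert (Ek : forall lam, kappa lam = PSeries (acoef t) (lam - lam_inf t))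
  by (intros lam; symmetry; apply is_pseries_unique, Hk).
assert (Hlin : forall lam, lam_inf t < lam ->
  kappa lam <= (lam - lam_inf t) * acoef t 1).
{ intros lam Hlam.
  rewrite Ek, PSeries_decr_1, acoef_0, Rplus_0_l by (eexists; apply Hk).
  apply Rmult_le_compat_l; [lra |].
  apply PSeries_le_first; [lra | |].
  - intros n. apply Rlt_le, Hneg. lia.
  - apply CV_radius_inside. now rewrite CV_radius_decr_1, HR. }
assert (H1 : acoef t 1 < 0) by (apply Hneg; lia).
split; [exact Hk | split; [apply acoef_0 | split; [exact Hneg | split]]].
- intros lam Hlam. split; [pose proof (Hlin lam Hlam); nra |].
  assert (Hd : is_derive kappa lam (PSeries (PS_derive (acoef t)) (lam - lam_inf t))).
  { eapply is_derive_ext; [intros; symmetry; apply Ek |].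
    assert (HP : is_derive (PSeries (acoef t)) (lam - lam_inf t)
                   (PSeries (PS_derive (acoef t)) (lam - lam_inf t)))
      by (apply is_derive_PSeries; now rewrite HR).
    rewrite <- (Rmult_1_l (PSeries _ _)).
    apply (is_derive_comp (V := R_NormedModule) (PSeries (acoef t))
             (fun l => l - lam_inf t)); [exact HP |].
    auto_derive; [trivial | ring]. }
  split; [eexists; exact Hd |].
  rewrite (is_derive_unique _ _ _ Hd).
  eapply Rle_lt_trans; [apply PSeries_le_first; [lra | |] |].
  + intros n. unfold PS_derive.
    pose proof (pos_INR (S n)).
    assert (acoef t (S n) < 0) by (apply Hneg; lia). nra.
  + apply CV_radius_inside. now rewrite CV_radius_derive, HR.
  + unfold PS_derive. simpl INR. lra.
- apply is_lim_spec. intros M. exists (Rmax (lam_inf t) (lam_inf t + M / acoef t 1)).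
  intros lam Hlam. apply Rmax_Rlt in Hlam as [Hl1 Hl2].
  apply Rle_lt_trans with (1 := Hlin lam Hl1).
  replace M with (M / acoef t 1 * acoef t 1) by (field; lra).
  nra.
Qed.
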